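(* Let $(X,+)$ be an Abelian group, let $D\subseteq X$, and let $\mathcal{R}\subseteq\mathcal{E}(X)\times[0,1]$ be a nonempty nonsingular relation such that $\operatorname{dom}(\mathcal{R})$ forms a pairwise commuting subfamily of $\mathcal{E}(X)$. Then a function $f:D\to[-\infty,+\infty[$ is $\mathcal{R}$-convex if and only if, for all $p\in D$, there exists an $\mathcal{R}$-affine function $a:D\to[-\infty,+\infty[$ such that $a(p)=f(p)$ and $a\leq f$ on $D$.
   Context: $\mathcal{E}(X)$ is the ring of all endomorphisms of the Abelian group $X$ (with pointwise addition and composition) and $I$ is the identity map. For $T\in\mathcal{E}(X)$, a set $D\subseteq X$ is $T$-convex if $T(x)+(I-T)(y)\in D$ for all $x,y\in D$. The convention $0\cdot(-\infty)=0$ is used. For $(T,t)\in\mathcal{E}(X)\times[0,1]$, a function $f:D\to[-\infty,+\infty[$ is $(T,t)$-convex if $D$ is $T$-convex and $f(T(x)+(I-T)(y))\leq tf(x)+(1-t)f(y)$ for all $x,y\in D$; it is $(T,t)$-affine if $D$ is $T$-convex and equality holds here for all $x,y\in D$. For $\mathcal{R}\subseteq\mathcal{E}(X)\times[0,1]$, $f$ is $\mathcal{R}$-convex (resp. $\mathcal{R}$-affine) if it is $(T,t)$-convex (resp. $(T,t)$-affine) for all $(T,t)\in\mathcal{R}$. $\operatorname{dom}(\mathcal{R}):=\{T\in\mathcal{E}(X)\mid\exists t\in\mathbb{R}:(T,t)\in\mathcal{R}\}$. The relation $\mathcal{R}$ is called nonsingular if $(T,0)\in\mathcal{R}$ implies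 $T=0$ and $(T,1)\in\mathcal{R}$ implies $T=I$. *)

(* Defs.v *)
From HB Require Import structures.
From mathcomp Require Import all_boot all_order all_algebra.
From mathcomp Require Import all_classical all_reals.

Set Implicit Arguments.
Unset Strict Implicit.
Unset Printing Implicit Defensive.

Import Order.TTheory GRing.Theory Num.Theory.
Local Open Scope classical_set_scope.
Local Open Scope ring_scope.

(* The endomorphism ring of X: pointwise operations \+, \- and \0, product \o
   and unit idfun. *)
Definition endo (X : zmodType) := {additive X -> X}.

Definition T_convex_set (X : zmodType) (T : endo X) (D : set X) : Prop :=
  forall x y, D x -> D y -> D (T x + (idfun \- T) y).

(* A function D -> [-oo, +oo[ is a total map X -> \bar R of which only the
   values on D matter; those values must differ from +oo. *)
Definition maps_below_pinfty (R : realType) (X : zmodType) (D : set X)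
    (f : X -> \bar R) : Prop :=
  forall x, D x -> (f x < +oo)%E.

(* In \bar R, 0 * -oo = 0. *)
Definition Tt_convex (R : realType) (X : zmodType) (T : endo X) (t : R)
    (D : set X) (f : X -> \bar R) : Prop :=
  T_convex_set T D /\
  forall x y, D x -> D y ->
    (f (T x + (idfun \- T) y)%R <= t%:E * f x + (1 - t)%:E * f y)%E.

Definition Tt_affine (R : realType) (X : zmodType) (T : endo X) (t : R)
    (D : set X) (f : X -> \bar R) : Prop :=
  T_convex_set T D /\
  forall x y, D x -> D y ->
    f (T x + (idfun \- T) y)%R = (t%:E * f x + (1 - t)%:E * f y)%E.

Definition rel_convex (R : realType) (X : zmodType) (Rel : set (endo X * R))
    (D : set X) (f : X -> \bar R) : Prop :=
  forall T t, Rel (T, t) -> Tt_convex T t D f.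

Definition rel_affine (R : realType) (X : zmodType) (Rel : set (endo X * R))
    (D : set X) (f : X -> \bar R) : Prop :=
  forall T t, Rel (T, t) -> Tt_affine T t D f.

Definition rel_dom (R : realType) (X : zmodType) (Rel : set (endo X * R)) :
    set (endo X) :=
  [set T | exists t : R, Rel (T, t)].

Definition pairwise_commuting (X : zmodType) (F : set (endo X)) : Prop :=
  forall S T, F S -> F T -> S \o T = T \o S.

Definition nonsingular (R : realType) (X : zmodType)
    (Rel : set (endo X * R)) : Prop :=
  (forall T, Rel (T, 0) -> T = \0 :> (X -> X)) /\
  (forall T, Rel (T, 1) -> T = idfun :> (X -> X)).

(* Main.v *)
Require Import Defs.
From mathcomp Require Import all_boot all_order all_algebra.
From mathcomp Require Import all_classical all_reals.
From mathcomp Require Import ring ereal.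

Local Open Scope classical_set_scope.
Local Open Scope ring_scope.

Import Order.TTheory GRing.Theory Num.Theory.

(** A pointwise supremum of affine minorants that is attained at every point
    is convex: this is the easy half. It is applied at the point
    [T x + (I - T) y] itself, where the affine support agrees with [f].

    For the other half, fix [p]. If [f p = -oo], the constant [-oo] supports
    [f] at [p]. Otherwise, Zorn's lemma gives a pointwise minimal element [g]
    among the convex functions below [f] with value [f p] at [p]
    ([exists_minimal_convex_at]); the point is that a minimal [g] is already
    affine ([minimal_convex_affine]).

    The mechanism is a rigidity property ([minimal_convex_rigid]). Let [phi] be
    a self-map of [D] that preserves the combinations [S x + (I - S) y], and
    suppose that [g (phi x) <= c * g x + k] on [D], with [c > 0] and equality
    at [p]. Then [(g (phi x) - k) / c] is convex in [x], lies below [g] and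
    agrees with [g] at [p], so it is [g]: the inequality is an equality
    everywhere. Commutativity enters because it makes the maps
    [x |-> T x + (I - T) y], with either argument fixed, preserve the
    combinations taken with every other [S].

    For [0 < t < 1] rigidity is used twice. The map
    [z |-> T p + (I - T) z] fixes [p], so convexity is an equality at [p], hence
    for all [z]: [g] is affine on combinations whose first argument is [p].
    That in turn is the equality at [p] needed by [x |-> T x + (I - T) y] when
    [g y] is finite, and gives the affine identity for all [x]. When
    [g y = -oo], convexity alone forces both sides to be [-oo]. When [t] is [0]
    or [1], nonsingularity makes the identity trivial. *)

(** [U] must be nonempty: its infimum would be [+oo], but [+oo - oo = -oo], so
    the conclusion would fail for [c = -oo]. *)
Lemma le_scale_ereal_inf_add {R : realType} (t : R) (U : set (\bar R))
    (L c : \bar R) :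
  0 <= t -> U !=set0 -> (c < +oo)%E ->
  (forall u, U u -> (L <= t%:E * u + c)%E) ->
  (L <= t%:E * ereal_inf U + c)%E.
Proof.
rewrite le_eqVlt => /predU1P[<-|t0] [u0 Uu0].
  by move=> _ HL; have := HL _ Uu0; rewrite !mul0e.
case: c => [c| |] // _ HL.
- rewrite -leeBlDr// -lee_pdivrMl//; apply: le_ereal_inf_tmp => u Uu.
  by rewrite lee_pdivrMl// leeBlDr//; exact: HL.
- by rewrite addeNy; have := HL _ Uu0; rewrite addeNy.
Qed.

(** The two sides could only differ through the convention [0 * -oo = 0], which
    intervenes for [s = 0] or [s = 1] and then acts in the same way on both. *)
Lemma convex_comb_affine {R : realType} (s r k : R) (u v : \bar R) :
  0 <= s <= 1 -> 0 < r -> (u < +oo)%E -> (v < +oo)%E ->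
  (r%:E * ((s%:E * u + (1 - s)%:E * v) - k%:E)
   = s%:E * (r%:E * (u - k%:E)) + (1 - s)%:E * (r%:E * (v - k%:E)))%E.
Proof.
move=> /andP[s0 s1] r0.
have rNy : (r%:E * -oo = -oo :> \bar R)%E by rewrite gt0_muleNy ?lte_fin.
move: s0; rewrite le_eqVlt => /predU1P[<-|s0].
  by rewrite subr0 !mul0e !mul1e !add0e.
move: s1; rewrite le_eqVlt => /predU1P[->|s1].
  by rewrite subrr !mul0e !mul1e !adde0.
have sNy : (s%:E * -oo = -oo :> \bar R)%E by rewrite gt0_muleNy ?lte_fin.
have s'Ny : ((1 - s)%:E * -oo = -oo :> \bar R)%E.
  by rewrite gt0_muleNy ?lte_fin ?subr_gt0.
case: u => [u| |] //; case: v => [v| |] // _ _.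
- by rewrite -!(EFinM, EFinB, EFinD); congr EFin; ring.
- by rewrite !(addeNy, addNye, rNy, sNy, s'Ny).
- by rewrite !(addeNy, addNye, rNy, sNy, s'Ny).
- by rewrite !(addeNy, addNye, rNy, sNy, s'Ny).
Qed.

Definition minimal_convex_at {R : realType} {X : zmodType}
    (Rel : set (endo X * R)) (D : set X) (p : X) (g : X -> \bar R) : Prop :=
  rel_convex Rel D g /\
  forall h, rel_convex Rel D h -> (forall x, D x -> (h x <= g x)%E) ->
    h p = g p -> forall x, D x -> (g x <= h x)%E.

(** For two members of the chain, one used at [x] and the other at [y], the
    smaller of the two is convex and bounds the value at the combination; then
    the infima at [x] and at [y] can be taken independently. *)
Lemma rel_convex_chain_inf {R : realType} {X : zmodType}
    (Rel : set (endo X * R)) (D : set X) (A : set (X -> \bar R)) :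
  (forall T t, Rel (T, t) -> 0 <= t <= 1) ->
  A !=set0 ->
  (forall g, A g -> rel_convex Rel D g) ->
  (forall g, A g -> maps_below_pinfty D g) ->
  total_on A (fun g h => forall x, D x -> (h x <= g x)%E) ->
  rel_convex Rel D (fun x => ereal_inf [set g x | g in A]).
Proof.
move=> Rel01 [g0 Ag0] Acvx Aoo Atot T t RelTt.
have [DT _] := Acvx _ Ag0 _ _ RelTt; split=> // x y Dx Dy.
have /andP[t0 t1] := Rel01 _ _ RelTt.
have inf_oo z : D z -> (ereal_inf [set g z | g in A] < +oo)%E.
  move=> Dz; apply: le_lt_trans (Aoo _ Ag0 _ Dz).
  by apply: ereal_inf_lbound; exists g0.
have scale_oo s (z : \bar R) : 0 <= s -> (z < +oo)%E -> (s%:E * z < +oo)%E.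
  by move=> s0 ?; apply: lte_mul_pinfty => //; rewrite lee_fin.
have t'0 : 0 <= 1 - t by rewrite subr_ge0.
apply: le_scale_ereal_inf_add => //.
- by exists (g0 x), g0.
- by apply: scale_oo => //; exact: inf_oo.
move=> _ [g Ag <-]; rewrite addeC; apply: le_scale_ereal_inf_add => //.
- by exists (g0 y), g0.
- by apply: scale_oo => //; exact: Aoo.
move=> _ [h Ah <-]; rewrite addeC.
have [m [Am mg mh]] : exists m, [/\ A m, (m x <= g x)%E & (m y <= h y)%E].
  by have [gh|hg] := Atot _ _ Ag Ah; [exists h|exists g]; split=> //; auto.
have [_ mcvx] := Acvx _ Am _ _ RelTt.
apply: (@le_trans _ _ (m (T x + (idfun \- T) y))).
  by apply: ereal_inf_lbound; exists m.
apply: le_trans (mcvx _ _ Dx Dy) _.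
by apply: leeD; apply: lee_wpmul2l => //; rewrite lee_fin.
Qed.

(** Zorn's lemma, with the infimum of a chain as its bound. Functions are
    compared on [D] only, so the order is merely a preorder. *)
Lemma exists_minimal_convex_at {R : realType} {X : zmodType}
    (Rel : set (endo X * R)) (D : set X) (p : X) (f : X -> \bar R) :
  (forall T t, Rel (T, t) -> 0 <= t <= 1) ->
  D p -> maps_below_pinfty D f -> rel_convex Rel D f ->
  exists g, [/\ minimal_convex_at Rel D p g, g p = f p &
               forall x, D x -> (g x <= f x)%E].
Proof.
move=> Rel01 Dp foo fcvx.
pose P g := [/\ rel_convex Rel D g, g p = f p &
               forall x, D x -> (g x <= f x)%E].
have Pf : P f by [].
pose below (g h : {g | P g}) :=
  `[< forall x, D x -> (sval h x <= sval g x)%E >].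
have [| | |g gmax] := @ZL_preorder _ (exist P f Pf) below.
- by move=> g; apply/asboolP.
- move=> h g k /asboolP hg /asboolP gk; apply/asboolP => x Dx.
  exact: le_trans (gk _ Dx) (hg _ Dx).
- move=> A Atot; have [[g0 Ag0]|A0] := pselect (A !=set0); last first.
    (* the empty chain, whose infimum would be [+oo] *)
    by exists (exist P f Pf) => g Ag; case: A0; exists g.
  pose B := [set sval g | g in A].
  pose m x := ereal_inf [set g x | g in B].
  have mle (g : {g | P g}) x : A g -> (m x <= sval g x)%E.
    by move=> Ag; apply: ereal_inf_lbound; exists (sval g) => //; exists g.
  have Pm : P m.
    split.
    + apply: rel_convex_chain_inf => //.
      * by exists (sval g0), g0.
      * by move=> _ [[g [? ? ?]] _ <-].
      * move=> _ [[g [? ? gf]] _ <-] x Dx.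
        exact: le_lt_trans (gf _ Dx) (foo _ Dx).
      * move=> _ _ [g Ag <-] [h Ah <-].
        by have [/asboolP|/asboolP] := Atot _ _ Ag Ah; [left|right].
    + apply/eqP; rewrite eq_le; apply/andP; split.
        by have := mle _ p Ag0; case: (svalP g0) => _ ->.
      by apply: le_ereal_inf_tmp => _ [_ [g _ <-] <-]; case: (svalP g) => _ ->.
    + move=> x Dx; apply: le_trans (mle _ x Ag0) _.
      by case: (svalP g0) => _ _; apply.
  by exists (exist P m Pm) => g Ag; apply/asboolP => x _; exact: mle.
- case: (svalP g) => gcvx gp gf; exists (sval g); split=> //; split=> //.
  move=> h hcvx hg hp.
  have Ph : P h.
    split=> //; first by rewrite hp.
    by move=> x Dx; exact: le_trans (hg _ Dx) (gf _ Dx).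
  by apply/asboolP; apply: (gmax (exist P h Ph)); apply/asboolP.
Qed.

Lemma rel_convex_conj {R : realType} {X : zmodType}
    (Rel : set (endo X * R)) (D : set X) (g : X -> \bar R) (phi : X -> X)
    (r k : R) :
  (forall T t, Rel (T, t) -> 0 <= t <= 1) ->
  maps_below_pinfty D g -> rel_convex Rel D g ->
  (forall x, D x -> D (phi x)) ->
  (forall S, rel_dom Rel S -> forall x y,
     phi (S x + (idfun \- S) y) = S (phi x) + (idfun \- S) (phi y)) ->
  0 < r ->
  rel_convex Rel D (fun x => r%:E * (g (phi x) - k%:E))%E.
Proof.
move=> Rel01 goo gcvx Dphi phiM r0 S s RelSs.
have [DS gS] := gcvx _ _ RelSs; split=> // x y Dx Dy.
rewrite phiM; last by exists s.
rewrite -convex_comb_affine//; [|exact: Rel01 RelSs|by apply: goo; auto..].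
apply: lee_wpmul2l; first by rewrite lee_fin ltW.
by apply: leeB => //; apply: gS; exact: Dphi.
Qed.

(** The function [x |-> (g (phi x) - k) / c] is a competitor in the definition
    of minimality, so [g] is below it, which is the missing inequality. *)
Lemma minimal_convex_rigid {R : realType} {X : zmodType}
    (Rel : set (endo X * R)) (D : set X) (p : X) (g : X -> \bar R)
    (phi : X -> X) (c k : R) :
  (forall T t, Rel (T, t) -> 0 <= t <= 1) ->
  maps_below_pinfty D g -> minimal_convex_at Rel D p g ->
  (forall x, D x -> D (phi x)) ->
  (forall S, rel_dom Rel S -> forall x y,
     phi (S x + (idfun \- S) y) = S (phi x) + (idfun \- S) (phi y)) ->
  0 < c ->
  (forall x, D x -> (g (phi x) <= c%:E * g x + k%:E)%E) ->
  g (phi p) = (c%:E * g p + k%:E)%E ->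
  forall x, D x -> g (phi x) = (c%:E * g x + k%:E)%E.
Proof.
move=> Rel01 goo [gcvx gmin] Dphi phiM c0 gle gp x Dx.
apply/eqP; rewrite eq_le gle//=.
rewrite -leeBrDr// -lee_pdivlMl//.
apply: (gmin (fun x => c^-1%:E * (g (phi x) - k%:E))%E) => //.
- by apply: rel_convex_conj => //; rewrite invr_gt0.
- by move=> z Dz; rewrite lee_pdivrMl// leeBlDr//; exact: gle.
- by rewrite gp addeK// muleA -EFinM mulVf ?gt_eqF// mul1e.
Qed.

(** Additivity and commutation handle the linear part of [x |-> U x + w], and
    the constant splits as [w = S w + (I - S) w]. Applied with [U = T] and with
    [U = I - T]. *)
Lemma affine_map_combination {X : zmodType} (S U : endo X) (w x y : X) :
  S \o U = U \o S ->
  U (S x + (idfun \- S) y) + w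
  = S (U x + w) + (idfun \- S) (U y + w).
Proof.
move=> SU; have {}SU v : S (U v) = U (S v) by have /(congr1 (@^~ v)) := SU.
rewrite /= !(raddfD, raddfN) /= !SU.
rewrite [RHS]addrACA [S w + _]addrCA subrr addr0.
by rewrite -!addrA [w - _]addrC.
Qed.

(** At [t = 0] or [t = 1] nonsingularity makes [T x + (I - T) y] equal to [y] or
    [x], and [0 * -oo = 0] removes the other value even when it is [-oo]. *)
Lemma endpoint_affine {R : realType} {X : zmodType}
    (Rel : set (endo X * R)) (T : endo X) (t : R) (g : X -> \bar R) (x y : X) :
  nonsingular Rel -> Rel (T, t) -> t = 0 \/ t = 1 ->
  g (T x + (idfun \- T) y) = (t%:E * g x + (1 - t)%:E * g y)%E.
Proof.
move=> [ns0 ns1] RelTt [] tE; subst t.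
- have -> : T x + (idfun \- T) y = y by rewrite /= (ns0 _ RelTt) subr0 add0r.
  by rewrite subr0 mul0e add0e mul1e.
- have -> : T x + (idfun \- T) y = x by rewrite /= (ns1 _ RelTt) subrr addr0.
  by rewrite subrr mul0e adde0 mul1e.
Qed.

(** Rigidity along [z |-> T p + (I - T) z], which fixes [p], supplies the
    equality at [p] required for rigidity along [x |-> T x + (I - T) y]. *)
Lemma minimal_convex_affine {R : realType} {X : zmodType}
    (Rel : set (endo X * R)) (D : set X) (p : X) (g : X -> \bar R) :
  (forall T t, Rel (T, t) -> 0 <= t <= 1) ->
  nonsingular Rel -> pairwise_commuting (rel_dom Rel) ->
  D p -> g p \is a fin_num -> maps_below_pinfty D g ->
  minimal_convex_at Rel D p g -> rel_affine Rel D g.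
Proof.
move=> Rel01 ns comm Dp gpfin goo gmin T t RelTt.
have [DT gT] := gmin.1 _ _ RelTt; split=> // x y Dx Dy.
have /andP[] := Rel01 _ _ RelTt.
rewrite le_eqVlt => /predU1P[t0 _|t0].
  by apply: endpoint_affine RelTt _; auto.
rewrite le_eqVlt => /predU1P[t1|t1].
  by apply: endpoint_affine RelTt _; auto.
have t'0 : 0 < 1 - t by rewrite subr_gt0.
have ST S : rel_dom Rel S -> S \o T = T \o S.
  by move=> ?; apply: comm => //; exists t.
have T'E z : (idfun \- T) z = z - T z by [].
have phip z : D z ->
    g (T p + (idfun \- T) z) = (t%:E * g p + (1 - t)%:E * g z)%E.
  rewrite -(fineK gpfin) -EFinM addrC [RHS]addeC => Dz.
  apply: (minimal_convex_rigid Rel D p g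
            (fun v => (idfun \- T) v + T p)) z Dz => //.
  - by move=> v Dv; rewrite addrC; exact: DT.
  - move=> S domS u v.
    apply: (@affine_map_combination _ S (idfun \- T : endo X)%R).
    apply/funext => w /=; have /(congr1 (@^~ w)) /= := ST S domS.
    by rewrite raddfB => ->.
  - by move=> v Dv; rewrite EFinM fineK// addrC addeC; exact: gT.
  - by rewrite T'E subrK EFinM fineK// -muleDl// -EFinD subrK mul1e.
have [gy|] := boolP (g y \is a fin_num).
  (* the intercept of the affine bound must be a real number *)
  rewrite -(fineK gy) -EFinM.
  apply: (minimal_convex_rigid Rel D p g
            (fun v => T v + (idfun \- T) y)) x Dx => //.
  - by move=> v Dv; exact: DT.
  - by move=> S domS u v; apply: affine_map_combination; exact: ST.
  - by move=> v Dv; rewrite EFinM fineK//; exact: gT.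
  - by rewrite phip// EFinM fineK.
have := goo _ Dy; have := gT _ _ Dx Dy; case: (g y) => // + _ _.
rewrite gt0_muleNy ?lte_fin// addeNy leeNy_eq.
by move=> /eqP.
Qed.

Theorem theorem5p12 (R : realType) (X : zmodType) (D : set X)
    (Rel : set (endo X * R))
    (Rel01 : Rel `<=` [set: endo X] `*` `[0, 1])
    (Rel0 : Rel !=set0)
    (Relns : nonsingular Rel)
    (Relcomm : pairwise_commuting (rel_dom Rel))
    (f : X -> \bar R) (fD : maps_below_pinfty D f) :
  rel_convex Rel D f <->
  (forall p, D p ->
     exists a : X -> \bar R,
       [/\ maps_below_pinfty D a, rel_affine Rel D a, a p = f p &
           forall x, D x -> (a x <= f x)%E]).
Proof.
have t01 T t : Rel (T, t) -> 0 <= t <= 1.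
  by move=> /Rel01[_] /=; rewrite in_itv.
split=> [fcvx p Dp|supp T t RelTt].
- have [fpfin|fpN] := boolP (f p \is a fin_num).
    have [g [gmin gpE gf]] :=
      exists_minimal_convex_at Rel D p f t01 Dp fD fcvx.
    have goo : maps_below_pinfty D g.
      by move=> x Dx; exact: le_lt_trans (gf _ Dx) (fD _ Dx).
    exists g; split=> //.
    by apply: minimal_convex_affine gmin => //; rewrite gpE.
  have fp : f p = -oo%E by move: fpN (fD _ Dp); case: (f p).
  exists (cst -oo%E); split=> // [T t RelTt|x _]; last exact: leNye.
  split=> [|x y _ _ /=]; first by have [] := fcvx _ _ RelTt.
  have /andP[] := t01 _ _ RelTt; rewrite le_eqVlt => /predU1P[<- _|t0 _].
    by rewrite mul0e subr0 mul1e add0e.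
  by rewrite gt0_muleNy ?lte_fin// addNye.
have DT : T_convex_set T D.
  move=> x y Dx; have [a [_ aff _ _]] := supp _ Dx.
  by have [DT _] := aff _ _ RelTt; exact: DT.
split=> // x y Dx Dy.
have [a [_ /(_ _ _ RelTt)[_ aT] <- af]] := supp _ (DT _ _ Dx Dy).
have /andP[t0 t1] := t01 _ _ RelTt.
rewrite aT//; apply: leeD; apply: lee_wpmul2l; rewrite ?lee_fin ?subr_ge0//.
all: exact: af.
Qed.
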